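(* Assume (A1)–(A4) on $\pi$ and $k$ and (B1)–(B3) on $(\pi_\ell)_{\ell\ge0}$. Let $d_{\rm lip}>0$ be the constant in the Lipschitz estimates (D) of the context. Then the mean-field limit at level $\ell$ is stable with respect to changes in $\pi_\ell$, in the sense that $$\mathcal W_2(\rho_n^\ell,\rho_n^{\ell-1})\le\mathbb E_0\big[\|Z_n^\ell-Z_n^{\ell-1}\|^2\big]^{1/2}\le C_{\rm app}\,2^{-\beta\ell}\big(e^{2d_{\rm lip}T}-1\big)\qquad(\ell\ge1)$$ and $$\mathcal W_2(\rho_n^\ell,\rho_n)\le\mathbb E_0\big[\|Z_n^\ell-Z_n\|^2\big]^{1/2}\le\frac{C_{\rm app}\,2^{-\beta\ell}}{2}\big(e^{2d_{\rm lip}T}-1\big)\qquad(\ell\ge0)$$ for all $n\le T/\gamma$.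
   Context: Fix $d\in\mathbb N$, a time horizon $T>0$, a step size $\gamma>0$, and a probability measure $\rho_0$ on $\mathbb R^d$ with finite first and second moments. Let $k:\mathbb R^d\times\mathbb R^d\to\mathbb R$ be a stationary ($k(x,y)$ depends only on $x-y$) positive definite kernel with reproducing kernel Hilbert space $\mathcal H_0$; let $\mathcal H$ be the product space of vector-valued functions with components in $\mathcal H_0$ and inner product $\langle f,g\rangle_{\mathcal H}=\sum_i\langle f_i,g_i\rangle_{\mathcal H_0}$. $\nabla_1 k$ is the gradient of $k$ in its first argument and $\nabla k$ the full gradient. Let $\pi$ (target) and $\pi_\ell$, $\ell\in\mathbb N_0$ (approximations of $\pi$ at accuracy level $\ell$) be probability densities on $\mathbb R^d$ and put $V=-\log\pi$, $V_\ell=-\log\pi_\ell$. $\|\cdot\|$ is the Euclidean (resp. operator) norm, $\mathcal P_2(\mathbb R^d)$ the set of probability measures with finite first and second moments, $\mathcal W_2$ the Wasserstein-2 distance. Assumptions on $\pi$ and $k$: there are finite constants $M,C_V,B,b_{\rm lip}>0$ such that (A1) $\|\nabla^2V(x)\|\le M$ for all $x$; (A2) $\|\nabla V(x)\|\le C_V$ for all $x$; (A3) $\|k(x,\cdot)\|_{\mathcal H_0}\le B$ and $\|\nabla_1k(x,\cdot)\|_{\mathcal H}\le B$ for all $x$; (A4) $k$ is continuously differentiable, and $|k(x,x')-k(y,y')|\le b_{\rm lip}(\|x-y\|+\|x'-y'\|)$ and $\|\nabla k(x,x')-\nabla k(y,y')\|\le b_{\rm lip}(\|x-y\|+\|x'-y'\|)$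 for all $x,x',y,y'$. Assumptions on $(\pi_\ell)$: there are finite constants $M,C_V,\beta,C_{\rm app}>0$ such that for all $x\in\mathbb R^d$, $\ell\in\mathbb N_0$: (B1) $\|\nabla^2V_\ell(x)\|\le M$; (B2) $\|\nabla V_\ell(x)\|\le C_V$; (B3) $\|\nabla\log\pi_\ell(x)-\nabla\log\pi(x)\|\le C_{\rm app}2^{-\beta\ell}$. For $\rho\in\mathcal P_2(\mathbb R^d)$ and a density $p$ write $$P_\rho\nabla\log\Big(\frac{\rho}{p}\Big)(z):=-\int_{\mathbb R^d}\big(k(x,z)\nabla\log p(x)+\nabla_1k(x,z)\big)\,\rho(dx)$$ (this is the definition of the left-hand side). Mean-field systems, on a probability space $(\Omega,\mathcal F,\mathbb P_0)$ with expectation $\mathbb E_0$: $$Z_{n+1}=Z_n-\gamma P_{\rho_n}\nabla\log\Big(\frac{\rho_n}{\pi}\Big)(Z_n),\qquad Z_0\sim\rho_0,$$ where $\rho_n$ is the law of $Z_n$; and for each $\ell\in\mathbb N_0$ $$Z_{n+1}^\ell=Z_n^\ell-\gamma P_{\rho_n^\ell}\nabla\log\Big(\frac{\rho_n^\ell}{\pi_\ell}\Big)(Z_n^\ell),$$ where $\rho_n^\ell$ is the law of $Z_n^\ell$, with i.i.d. initialization $Z_0^\ell\sim\rho_0$, $\ell\in\mathbb N_0$. (D): under (A1)–(A4) and (B1)–(B3) there exists $d_{\rm lip}>0$, depending on the constants in these assumptions, such that (for all $z_1,z_2\in\mathbb R^d$ and $\rho_1,\rho_2\in\mathcal P_2(\mathbb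 R^d)$) $$\Big\|P_{\rho_1}\nabla\log\Big(\frac{\rho_1}{\pi_\ell}\Big)(z_1)-P_{\rho_2}\nabla\log\Big(\frac{\rho_2}{\pi_{\ell-1}}\Big)(z_2)\Big\|\le d_{\rm lip}\big[\|z_1-z_2\|+\mathcal W_2(\rho_1,\rho_2)+2^{-\beta\ell}\big]$$ and the same bound holds with $\pi_{\ell-1}$ replaced by $\pi$. The constant $d_{\rm lip}$ in the claim is this one.
   Formalization: All systems start from one common variable Z_0^ℓ = Z_0 ∼ ρ_0, not i.i.d. copies (with those the bounds fail at n = 0), and d_lip is a suitable constant, depending only on d and the assumptions' constants, for which (D) and the bounds hold, not any constant satisfying (D). *)

(* Defs.v *)
From HB Require Import structures.
From mathcomp Require Import all_boot all_order all_algebra.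
From mathcomp Require Import all_classical all_reals all_analysis measurable_realfun.

Set Implicit Arguments.
Unset Strict Implicit.
Unset Printing Implicit Defensive.

Import Order.TTheory GRing.Theory Num.Theory.
Import numFieldNormedType.Exports.

Local Open Scope classical_set_scope.
Local Open Scope ring_scope.

(* R^n is 'rV[R]_n. The norm `|x| that the library puts on it is the sup norm:
   it gives the topology and differentiability, but distances and bounds are
   measured with the Euclidean norm below. *)

Section euclidean.
Context {R : realType}.

Definition enorm n (x : 'rV[R]_n) : R := Num.sqrt (\sum_(j < n) x 0 j ^+ 2).

(* A acts on row vectors by v *m A; A and A^T have the same operator norm. *)
Definition opnorm m n (A : 'M[R]_(m, n)) : R :=
  sup [set enorm (v *m A) | v in [set v : 'rV[R]_m | enorm v <= 1]].

Definition grad n (f : 'rV[R]_n -> R) (x : 'rV[R]_n) : 'rV[R]_n :=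
  \row_j 'D_(delta_mx 0 j) f x.

Definition hessian n (f : 'rV[R]_n -> R) (x : 'rV[R]_n) : 'M[R]_n :=
  'J (grad f) x.

Definition twice_differentiable n (f : 'rV[R]_n -> R) : Prop :=
  (forall x, differentiable f x) /\ (forall x, differentiable (grad f) x).

End euclidean.

Section borel_rV.
Context {R : realType} (n : nat).

HB.instance Definition _ :=
  @isMeasurable.Build (sigma_display (@open 'rV[R]_n)) 'rV[R]_n
    <<s @open 'rV[R]_n >> (@sigma_algebra0 _ setT _) (@sigma_algebraC _ _)
    (@sigma_algebra_bigcup _ setT _).

Lemma rV_open_measurable (A : set 'rV[R]_n) : open A -> measurable A.
Proof. by move=> oA; apply: sub_sigma_algebra. Qed.

Lemma rV_measurable_coord (j : 'I_n) :
  measurable_fun [set: 'rV[R]_n] (fun v : 'rV[R]_n => v 0 j).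
Proof.
apply: (@measurability _ _ 'rV[R]_n (measurableTypeR R) setT (fun v => v 0 j)
  _ (RGenOpens.measurableE R)).
move=> _ [_ [a [b ->]] <-]; rewrite setTI; apply: rV_open_measurable.
apply: open_comp; last exact: interval_open.
by move=> x _; exact: coord_continuous.
Qed.

Lemma rV_measurable_funP d (T : measurableType d) (f : T -> 'rV[R]_n) :
  (forall j, measurable_fun [set: T] (fun t => f t 0 j)) ->
  measurable_fun [set: T] f.
Proof.
move=> mf; apply: (measurability (@open 'rV[R]_n)) => //.
move=> _ [U oU <-]; rewrite setTI.
pose B (qk : 'rV[rat]_n * nat) : set 'rV[R]_n :=
  [set v | forall j, `|ratr (qk.1 0 j) - v 0 j| < qk.2.+1%:R^-1].
have mB qk : measurable (f @^-1` B qk).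
  rewrite [X in measurable X](_ : _ = \bigcap_(j in [set: 'I_n])
      (fun t => f t 0 j) @^-1` ball (ratr (qk.1 0 j) : R) qk.2.+1%:R^-1).
    apply: fin_bigcap_measurable => // j _.
    rewrite -[X in measurable X]setTI; apply: mf => //.
    by apply: open_measurable; exact: ball_open.
  by apply/seteqP; split => t /= h j => [_|]; exact: h.
rewrite [X in measurable X](_ : _ = \bigcup_qk
    (if `[< B qk `<=` U >] then f @^-1` B qk else set0)).
  apply: countable_bigcupT_measurable => // qk.
  by case: ifP.
apply/seteqP; split => [t /= Ut|t [qk _]]; last by case: asboolP => // + /=; apply.
have : nbhs (f t) U by exact: open_nbhs_nbhs.
move=> /nbhs_ballP[e /= e0 eU].
have [k ke] : exists k : nat, k.+1%:R^-1 < e / 2.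
  have [k _ /(_ k (leqnn k))] := near_infty_natSinv_lt (PosNum (divr_gt0 e0 (ltr0Sn R 1))).
  by exists k.
have [q Hq] : exists q : 'rV[rat]_n,
    forall j, `|ratr (q 0 j) - f t 0 j| < (k.+1%:R^-1 : R).
  have /choice[q Hq] : forall j, exists r : rat,
      `|ratr r - f t 0 j| < (k.+1%:R^-1 : R).
    move=> j; have k0 : 0 < (k.+1%:R^-1 : R) by rewrite invr_gt0.
    have lt0 : f t 0 j - k.+1%:R^-1 < f t 0 j + k.+1%:R^-1.
      by rewrite ltrBlDr -addrA ltrDl addr_gt0.
    have [r /itvP Hr] := rat_in_itvoo lt0; exists r.
    by rewrite ltr_distl !Hr.
  by exists (\row_j q j) => j; rewrite mxE.
exists (q, k) => //; case: asboolP => //= BU; exfalso; apply: BU.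
move=> v Bv; apply: eU; split => // i j; rewrite (ord1 i) /ball /=.
rewrite (le_lt_trans (ler_distD (ratr (q 0 j)) _ _))// [ltRHS]splitr ltrD//.
  by rewrite distrC (lt_trans (Hq j)).
exact: lt_trans (Bv j) ke.
Qed.

End borel_rV.

Section lebesgue_rV.
Context {R : realType}.

Definition rV_cons n (p : 'rV[R]_n * measurableTypeR R) : 'rV[R]_n.+1 :=
  row_mx (const_mx p.2 : 'rV[R]_1) p.1.

Lemma measurable_rV_cons n :
  measurable_fun [set: 'rV[R]_n * measurableTypeR R] (@rV_cons n).
Proof.
apply: rV_measurable_funP => j.
have [i|i] := split_ordP (j : 'I_(1 + n)) => ->.
- rewrite [X in measurable_fun _ X](_ : _ = snd); first exact: measurable_snd.
  by apply/funext => t; rewrite [LHS](row_mxEl _ _ 0 i) mxE.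
- rewrite [X in measurable_fun _ X](_ : _ = (fun v : 'rV[R]_n => v 0 i) \o fst).
    exact: (measurableT_comp (rV_measurable_coord i) measurable_fst).
  by apply/funext => t; rewrite [LHS](row_mxEr _ _ 0 i).
Qed.

Section succ.
Variables (n : nat) (mu : {measure set 'rV[R]_n -> \bar R}).

Definition lebesgue_rV_succ : set 'rV[R]_n.+1 -> \bar R :=
  pushforward (mu \x @lebesgue_measure R)%E (@rV_cons n).

HB.instance Definition _ := Measure.copy lebesgue_rV_succ
  (measure_function_pushforward__canonical__measure_function_Measure
    (mu \x @lebesgue_measure R)%E (@measurable_rV_cons n)).

End succ.

Fixpoint lebesgue_rV n : {measure set 'rV[R]_n -> \bar R} :=
  match n with
  | 0 => dirac (0 : 'rV[R]_0)
  | n'.+1 => lebesgue_rV_succ (lebesgue_rV n')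
  end.

(* Positivity is what makes - log p real-valued. *)
Definition prob_density n (p : 'rV[R]_n -> R) : Prop :=
  [/\ forall x, 0 < p x,
      measurable_fun [set: 'rV[R]_n] p &
      (\int[lebesgue_rV n]_x (p x)%:E)%E = 1%E].

Definition potential n (p : 'rV[R]_n -> R) (x : 'rV[R]_n) : R := - ln (p x).

End lebesgue_rV.

Section rkhs.
Context {R : realType}.

Definition stationary n (k : 'rV[R]_n -> 'rV[R]_n -> R) : Prop :=
  exists phi : 'rV[R]_n -> R, forall x y, k x y = phi (x - y).

Definition pos_def_kernel (X : Type) (k : X -> X -> R) : Prop :=
  (forall x y, k x y = k y x) /\
  forall (m : nat) (x : 'I_m -> X) (c : 'I_m -> R),
    0 <= \sum_(i < m) \sum_(j < m) c i * c j * k (x i) (x j).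

(* The reproducing kernel Hilbert space of k, as a Hilbert space of functions;
   the values of rk_dot outside rk_mem are irrelevant. By Moore-Aronszajn it
   exists, and rk_mem and rk_dot on rk_mem are unique, when k is positive
   definite. *)
Record rkhs (X : Type) (k : X -> X -> R) := RKHS {
  rk_mem : set (X -> R);
  rk_dot : (X -> R) -> (X -> R) -> R;
  rk_mem0 : rk_mem (fun=> 0);
  rk_mem_lin : forall a f g, rk_mem f -> rk_mem g ->
    rk_mem (fun x => a * f x + g x);
  rk_dot_lin : forall a f g h, rk_mem f -> rk_mem g -> rk_mem h ->
    rk_dot (fun x => a * f x + g x) h = a * rk_dot f h + rk_dot g h;
  rk_dot_sym : forall f g, rk_mem f -> rk_mem g -> rk_dot f g = rk_dot g f;
  rk_dot_ge0 : forall f, rk_mem f -> 0 <= rk_dot f f;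
  rk_dot_eq0 : forall f, rk_mem f -> rk_dot f f = 0 -> f = (fun=> 0);
  rk_complete : forall u : nat -> X -> R, (forall n, rk_mem (u n)) ->
    (forall e : R, 0 < e -> exists N : nat, forall n m, (N <= n)%N -> (N <= m)%N ->
      Num.sqrt (rk_dot (fun x => u n x - u m x) (fun x => u n x - u m x)) < e) ->
    exists2 f, rk_mem f &
      (fun n => Num.sqrt (rk_dot (fun x => u n x - f x) (fun x => u n x - f x)))
        @ \oo --> (0 : R);
  rk_kernel : forall x, rk_mem (k x);
  rk_reproducing : forall f x, rk_mem f -> rk_dot f (k x) = f x
}.

Definition rk_norm (X : Type) (k : X -> X -> R) (H : rkhs k) (f : X -> R) : R :=
  Num.sqrt (rk_dot H f f).

(* The product space of R^n-valued functions with components in H. *)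
Definition rkv_mem (X : Type) (k : X -> X -> R) (H : rkhs k) n
    (f : X -> 'rV[R]_n) : Prop :=
  forall i, rk_mem H (fun x => f x 0 i).

Definition rkv_dot (X : Type) (k : X -> X -> R) (H : rkhs k) n
    (f g : X -> 'rV[R]_n) : R :=
  \sum_(i < n) rk_dot H (fun x => f x 0 i) (fun x => g x 0 i).

Definition rkv_norm (X : Type) (k : X -> X -> R) (H : rkhs k) n
    (f : X -> 'rV[R]_n) : R :=
  Num.sqrt (rkv_dot H f f).

End rkhs.

Section assumptions.
Context {R : realType} {n : nat}.
Implicit Types (p : 'rV[R]_n -> R) (k : 'rV[R]_n -> 'rV[R]_n -> R).

Definition grad1 k (x y : 'rV[R]_n) : 'rV[R]_n := grad (fun u => k u y) x.

Definition grad2 k (x y : 'rV[R]_n) : 'rV[R]_n := grad (k x) y.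

Definition full_grad k (x y : 'rV[R]_n) : 'rV[R]_(n + n) :=
  row_mx (grad1 k x y) (grad2 k x y).

Definition potential_bounds (M CV : R) p : Prop :=
  [/\ twice_differentiable (potential p),
      forall x, opnorm (hessian (potential p) x) <= M &
      forall x, enorm (grad (potential p) x) <= CV].

Definition kernel_bounded (B : R) k (H : rkhs k) : Prop :=
  [/\ forall x, rk_norm H (k x) <= B,
      forall x, rkv_mem H (grad1 k x) &
      forall x, rkv_norm H (grad1 k x) <= B].

Definition kernel_C1_lipschitz (blip : R) k : Prop :=
  [/\ forall z : 'rV[R]_n * 'rV[R]_n, differentiable (fun z => k z.1 z.2) z,
      continuous (fun z : 'rV[R]_n * 'rV[R]_n => full_grad k z.1 z.2),
      forall x x' y y',
        `|k x x' - k y y'| <= blip * (enorm (x - y) + enorm (x' - y')) &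
      forall x x' y y',
        enorm (full_grad k x x' - full_grad k y y')
          <= blip * (enorm (x - y) + enorm (x' - y'))].

Definition score_approx (Capp beta : R) p (pl : nat -> 'rV[R]_n -> R) : Prop :=
  forall (l : nat) x,
    enorm (grad (fun y => ln (pl l y)) x - grad (fun y => ln (p y)) x)
      <= Capp * 2 `^ (- (beta * l%:R)).

End assumptions.

Section wasserstein.
Context {R : realType} {n : nat}.
Implicit Types rho : probability 'rV[R]_n R.
Local Open Scope ereal_scope.

Definition in_P2 rho : Prop :=
  \int[rho]_x (enorm x)%:E < +oo /\ \int[rho]_x (enorm x ^+ 2)%:E < +oo.

Definition coupling rho1 rho2
    (g : probability ('rV[R]_n * 'rV[R]_n)%type R) : Prop :=
  (forall A, measurable A -> g (fst @^-1` A) = rho1 A) /\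
  (forall A, measurable A -> g (snd @^-1` A) = rho2 A).

Definition W2 rho1 rho2 : \bar R :=
  (ereal_inf [set \int[g]_z (enorm (z.1 - z.2) ^+ 2)%:E | g in coupling rho1 rho2])
    `^ 2^-1.

End wasserstein.

Section svgd.
Context {R : realType} {n : nat}.
Implicit Types (p : 'rV[R]_n -> R) (k : 'rV[R]_n -> 'rV[R]_n -> R).

(* P_rho grad log (rho / p) (z) *)
Definition svgd_field k p (rho : probability 'rV[R]_n R) (z : 'rV[R]_n) :
    'rV[R]_n :=
  - \row_j \int[rho]_x (k x z *: grad (fun y => ln (p y)) x + grad1 k x z) 0 j.

Definition mean_field_system d (Om : measurableType d) (P0 : probability Om R)
    (gamma : R) k p (Z : nat -> {RV P0 >-> 'rV[R]_n}) : Prop :=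
  forall (m : nat) (w : Om),
    Z m.+1 w = Z m w - gamma *: svgd_field k p (distribution P0 (Z m)) (Z m w).

Definition lipschitz_estimates (dlip beta : R) k p (pl : nat -> 'rV[R]_n -> R) :
    Prop :=
  forall (z1 z2 : 'rV[R]_n) (rho1 rho2 : probability 'rV[R]_n R),
    in_P2 rho1 -> in_P2 rho2 ->
    (forall l : nat, (1 <= l)%N ->
      ((enorm (svgd_field k (pl l) rho1 z1 - svgd_field k (pl l.-1) rho2 z2))%:E
        <= dlip%:E * ((enorm (z1 - z2))%:E + W2 rho1 rho2
                        + (2 `^ (- (beta * l%:R)))%:E))%E) /\
    (forall l : nat,
      ((enorm (svgd_field k (pl l) rho1 z1 - svgd_field k p rho2 z2))%:E
        <= dlip%:E * ((enorm (z1 - z2))%:E + W2 rho1 rho2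
                        + (2 `^ (- (beta * l%:R)))%:E))%E).

Definition L2dist d (Om : measurableType d) (P0 : probability Om R)
    (X Y : {RV P0 >-> 'rV[R]_n}) : \bar R :=
  ('E_P0[fun w => (enorm (X w - Y w) ^+ 2)%R] `^ 2^-1)%E.

End svgd.

(* Main.v *)
Require Import Defs.
From HB Require Import structures.
From mathcomp Require Import all_boot all_order all_algebra.
From mathcomp Require Import all_classical all_reals all_analysis measurable_realfun.
From mathcomp Require Import ring lra.

Set Implicit Arguments.
Unset Strict Implicit.
Unset Printing Implicit Defensive.

Import Order.TTheory GRing.Theory Num.Theory.
Import numFieldNormedType.Exports.

Local Open Scope classical_set_scope.
Local Open Scope ring_scope.

(** The proof is a discrete Gronwall argument for the synchronous coupling of
two mean-field systems, namely the joint law of the two processes started at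
the same random point.

The field of a system is the average over [x], under its law, of the integrand
k(x, z) grad log p(x) + grad1 k(x, z). The assumptions bound the two factors
and make them Lipschitz in [x] and [z]: the reproducing property with
Cauchy-Schwarz bounds k and grad1 k by B^2, and the mean value theorem turns
the bound on the Hessian of - log p into a Lipschitz bound on the score. So
two integrands, for two densities whose scores differ by at most delta, satisfy
a pointwise bound with Lipschitz constant K and an offset B^2 delta
([svgd_integrand_lipschitz]). Integrating that bound against any coupling of
the two laws with root mean square cost [w] bounds the difference of the two fields
by a multiple of |z1 - z2| + w + delta ([svgd_field_lipschitz]), and the infimum
over couplings gives the estimate in terms of the Wasserstein distance
([coupling_lipschitz_W2]).

For the stability, let u be the root mean square distance of the two processes
at one time. The joint law is a coupling of cost u, so one step of size gamma
yields, with Lyapunov's inequality ([second_moment_affine_le]), at most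
u + gamma L (2 u + delta) at the next time. Since the processes start together,
the n-th distance is at most (delta / 2) ((1 + 2 gamma L)^n - 1)
([mean_field_stability]), which is at most (delta / 2) (exp (2 L T) - 1).

The claimed bound is linear in Capp, whereas the source term of the Lipschitz
estimates is 2^(-beta l) without the factor Capp. Applying those estimates as
they stand would lose this factor when Capp < 1. So the field is first estimated
with the sharper delta = Capp 2^(-beta l) and some constant L, and
dlip = L (1 + Capp) is chosen, which is large enough for the source term
2^(-beta l) as well; the recursion is run with dlip and the sharper delta. *)

(** * The Euclidean norm *)

Section euclidean_norm.
Context {R : realType}.

(** The common core of the Cauchy-Schwarz inequalities in R^n and in the
reproducing kernel Hilbert space. *)
Lemma quadratic_ge0_discr (a b c : R) :
  (forall t, 0 <= a + t * b * 2 + t ^+ 2 * c) -> 0 <= c -> b ^+ 2 <= a * c.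
Proof.
move=> h; rewrite le_eqVlt => /predU1P[c0|c0]; last first.
  (* the minimum of the quadratic is at t = - b / c *)
  have := h (- (b / c)); have -> : a + - (b / c) * b * 2 + (- (b / c)) ^+ 2 * c
    = (a * c - b ^+ 2) / c by field; rewrite gt_eqF.
  by rewrite ler_pdivlMr// mul0r subr_ge0.
have [->|b0] := eqVneq b 0; first by rewrite -c0 mulr0 expr0n.
(* when c = 0 and b <> 0 the affine function takes the value - 1 here *)
have := h (- (a + 1) / (b * 2)); rewrite -c0 mulr0 addr0.
by rewrite -mulrA mulfVK ?mulf_neq0// ?pnatr_eq0//; lra.
Qed.

Context {n : nat}.
Implicit Types v w : 'rV[R]_n.

Lemma enorm_ge0 v : 0 <= enorm v. Proof. exact: sqrtr_ge0. Qed.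

Lemma enorm_sqr v : enorm v ^+ 2 = \sum_j v 0 j ^+ 2.
Proof. by rewrite sqr_sqrtr// sumr_ge0// => j _; exact: sqr_ge0. Qed.

Lemma enorm0 : enorm (0 : 'rV[R]_n) = 0.
Proof.
by rewrite /enorm big1 ?sqrtr0// => j _; rewrite mxE expr0n.
Qed.

Lemma enormZ a v : enorm (a *: v) = `|a| * enorm v.
Proof.
rewrite /enorm -[`|a|]ger0_norm// -sqrtr_sqr -sqrtrM ?sqr_ge0//.
congr Num.sqrt; rewrite real_normK ?num_real// mulr_sumr.
by apply: eq_bigr => j _; rewrite mxE exprMn.
Qed.

Lemma enormN v : enorm (- v) = enorm v.
Proof. by rewrite -scaleN1r enormZ normrN1 mul1r. Qed.

Lemma le_coord_enorm v j : `|v 0 j| <= enorm v.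
Proof.
rewrite -sqrtr_sqr ler_wsqrtr// (bigD1 j)//= lerDl sumr_ge0// => i _.
exact: sqr_ge0.
Qed.

Lemma enorm_eq0 v : enorm v = 0 -> v = 0.
Proof.
move=> v0; apply/rowP => j; rewrite mxE; apply/eqP; rewrite -normr_le0 -v0.
exact: le_coord_enorm.
Qed.

Lemma enorm_triangle v w : enorm (v + w) <= enorm v + enorm w.
Proof.
pose b := \sum_j v 0 j * w 0 j.
have expand t : \sum_j (v 0 j + t * w 0 j) ^+ 2
    = enorm v ^+ 2 + t * b * 2 + t ^+ 2 * enorm w ^+ 2.
  rewrite !enorm_sqr /b mulrAC !mulr_sumr -!big_split/=.
  by apply: eq_bigr => j _; ring.
have /quadratic_ge0_discr/(_ (sqr_ge0 _)) bvw t :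
    0 <= enorm v ^+ 2 + t * b * 2 + t ^+ 2 * enorm w ^+ 2.
  by rewrite -expand sumr_ge0// => j _; exact: sqr_ge0.
have {}bvw : b <= enorm v * enorm w.
  rewrite (le_trans (ler_norm _))// -(@ler_pXn2r _ 2)// ?nnegrE//.
    by rewrite real_normK ?num_real// exprMn.
  by rewrite mulr_ge0 ?enorm_ge0.
rewrite -(@ler_pXn2r _ 2)// ?nnegrE ?addr_ge0 ?enorm_ge0// sqrrD enorm_sqr.
have := expand 1; under eq_bigr do rewrite mul1r.
under [X in _ -> X <= _]eq_bigr do rewrite mxE.
by move=> ->; rewrite expr1n !mul1r -[_ *+ 2]mulr_natr; nra.
Qed.

Lemma enorm_le_sum v : enorm v <= \sum_j `|v 0 j|.
Proof.
rewrite -(@ler_pXn2r _ 2)// ?nnegrE ?enorm_ge0 ?sumr_ge0// enorm_sqr.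
have [] // : \sum_j v 0 j ^+ 2 <= (\sum_j `|v 0 j|) ^+ 2 /\ 0 <= \sum_j `|v 0 j|.
elim/big_ind2: _ => [|x1 x2 y1 y2 [h1 p1] [h2 p2]|i _].
- by rewrite expr0n.
- by split; [nra|exact: addr_ge0].
- by rewrite real_normK ?num_real.
Qed.

(** The dimension on the right is a crude factor, harmless here since the
Lipschitz constants may depend on the dimension; it allows every vector
estimate below to be made coordinate by coordinate. *)
Lemma enorm_le_coord v c : (forall j, `|v 0 j| <= c) -> enorm v <= n%:R * c.
Proof.
move=> vc; rewrite (le_trans (enorm_le_sum v))// mulr_natl -[n in leRHS]card_ord.
by rewrite -sumr_const ler_sum.
Qed.

End euclidean_norm.

(** * First and second moments *)

Section second_moment.
Context d (T : measurableType d) (R : realType) (P : probability T R).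
Implicit Types f g X Y : T -> R.

Lemma integral_le_affine f X Y (a b c r s : R) :
  measurable_fun [set: T] f -> measurable_fun [set: T] X ->
  measurable_fun [set: T] Y ->
  (forall t, 0 <= f t) -> (forall t, 0 <= X t) -> (forall t, 0 <= Y t) ->
  0 <= a -> 0 <= b -> 0 <= c ->
  (\int[P]_t (X t)%:E <= r%:E)%E -> (\int[P]_t (Y t)%:E <= s%:E)%E ->
  (forall t, f t <= a * X t + b * Y t + c) ->
  (\int[P]_t (f t)%:E <= (a * r + b * s + c)%:E)%E.
Proof.
move=> mf mX mY f0 X0 Y0 a0 b0 c0 Xr Ys fle.
have maX : measurable_fun [set: T] (fun t => a%:E * (X t)%:E)%E.
  by apply: emeasurable_funM => //; exact/measurable_EFinP.
have mbY : measurable_fun [set: T] (fun t => b%:E * (Y t)%:E)%E.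
  by apply: emeasurable_funM => //; exact/measurable_EFinP.
have aX0 t : (0 <= a%:E * (X t)%:E)%E by rewrite -EFinM lee_fin mulr_ge0.
have bY0 t : (0 <= b%:E * (Y t)%:E)%E by rewrite -EFinM lee_fin mulr_ge0.
apply: (@le_trans _ _
    (\int[P]_t (a%:E * (X t)%:E + b%:E * (Y t)%:E + c%:E))%E).
  apply: ge0_le_integral => //=.
  - by move=> t _; rewrite lee_fin.
  - exact/measurable_EFinP.
  - by apply: emeasurable_funD => //; exact: emeasurable_funD.
  - by move=> t _; rewrite -!EFinM -!EFinD lee_fin.
rewrite ge0_integralD//; last 2 first.
- by move=> t _; rewrite adde_ge0.
- by apply: emeasurable_funD.
rewrite ge0_integralD// integral_cst//= probability_setT mule1.
rewrite !ge0_integralZl//; [|exact/measurable_EFinP|..|exact/measurable_EFinP|];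
  try by move=> t _; rewrite lee_fin.
by rewrite !EFinD !EFinM !leeD// lee_wpmul2l// lee_fin.
Qed.

Section moments.
Context (X : T -> R) (s : R).
Context (mX : measurable_fun [set: T] X) (X0 : forall t, 0 <= X t).
Context (s0 : 0 <= s) (Xs : (\int[P]_t (X t ^+ 2)%:E <= (s ^+ 2)%:E)%E).

Let mX2 : measurable_fun [set: T] (fun t => X t ^+ 2).
Proof. exact: measurable_funX. Qed.

(** Lyapunov's inequality, from X <= X^2 / (2 r) + r / 2 integrated for every
r > s; a strict inequality because s may vanish. *)
Lemma first_moment_le : (\int[P]_t (X t)%:E <= s%:E)%E.
Proof.
suff H r : s < r -> (\int[P]_t (X t)%:E <= r%:E)%E.
  by apply/lee_addgt0Pr => e e0; rewrite -EFinD; apply: H; rewrite ltrDl.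
move=> sr; have r0 : 0 < r by exact: le_lt_trans sr.
have -> : r = (2 * r)^-1 * r ^+ 2 + 0 * r ^+ 2 + r / 2.
  by field; rewrite gt_eqF.
have Xr : (\int[P]_t (X t ^+ 2)%:E <= (r ^+ 2)%:E)%E.
  by rewrite (le_trans Xs)// lee_fin ler_pXn2r// ?nnegrE// ltW.
apply: (integral_le_affine _ mX2 mX2 _ _ _ _ _ _ Xr Xr) => //.
- by move=> t; exact: sqr_ge0.
- by move=> t; exact: sqr_ge0.
- by rewrite invr_ge0 mulr_ge0// ltW.
- by rewrite divr_ge0// ltW.
move=> t; rewrite -subr_ge0.
have -> : (2 * r)^-1 * X t ^+ 2 + 0 * X t ^+ 2 + r / 2 - X t
    = (X t - r) ^+ 2 / (2 * r) by field; rewrite gt_eqF.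
by rewrite divr_ge0 ?sqr_ge0// mulr_ge0// ltW.
Qed.

(** Minkowski's inequality in L^2 against a constant: expand the square and
bound the cross term with the first moment. *)
Lemma second_moment_affine_le f (a b : R) : 0 <= a -> 0 <= b ->
  measurable_fun [set: T] f -> (forall t, 0 <= f t <= a * X t + b) ->
  (\int[P]_t (f t ^+ 2)%:E <= ((a * s + b) ^+ 2)%:E)%E.
Proof.
move=> a0 b0 mf fle.
have -> : (a * s + b) ^+ 2 = a ^+ 2 * s ^+ 2 + 2 * a * b * s + b ^+ 2 by ring.
apply: (integral_le_affine _ mX2 mX _ _ X0 _ _ _ Xs first_moment_le).
- exact: measurable_funX.
- by move=> t; exact: sqr_ge0.
- by move=> t; exact: sqr_ge0.
- exact: sqr_ge0.
- by rewrite !mulr_ge0.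
- exact: sqr_ge0.
move=> t; have /andP[f0 fl] := fle t.
have -> : a ^+ 2 * X t ^+ 2 + 2 * a * b * X t + b ^+ 2 = (a * X t + b) ^+ 2.
  by ring.
by rewrite ler_pXn2r ?nnegrE// (le_trans f0).
Qed.

End moments.

End second_moment.

(** * Gradients and Lipschitz functions *)

Section gradients.
Context {R : realType}.

(** The supremum that defines [opnorm] is a genuine bound only because the set
is bounded, here by [n] times the sum of the absolute values of all entries. *)
Lemma enorm_mulmx_le m n (v : 'rV[R]_m) (A : 'M[R]_(m, n)) :
  enorm (v *m A) <= opnorm A * enorm v.
Proof.
have [/enorm_eq0->|v0] := eqVneq (enorm v) 0.
  by rewrite mul0mx !enorm0 mulr0.
have vgt0 : 0 < enorm v by rewrite lt_def v0 enorm_ge0.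
rewrite -ler_pdivrMr// mulrC -[_^-1]ger0_norm ?invr_ge0 ?enorm_ge0//.
rewrite -enormZ scalemxAl; apply: ub_le_sup; last first.
  exists ((enorm v)^-1 *: v) => //=.
  by rewrite enormZ ger0_norm ?invr_ge0 ?enorm_ge0// mulVf.
exists (n%:R * \sum_j \sum_i `|A i j|) => _ [u /= u1 <-].
apply: enorm_le_coord => j; rewrite mxE (le_trans (ler_norm_sum _ _ _))//.
rewrite [leRHS](bigD1 j)//= -[leLHS]addr0 lerD ?sumr_ge0//.
  apply: ler_sum => i _; rewrite normrM ler_piMl//.
  exact: le_trans (le_coord_enorm _ _) u1.
by move=> i _; rewrite sumr_ge0.
Qed.

Context {n : nat}.
Implicit Types (f : 'rV[R]_n -> R) (v x y : 'rV[R]_n).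

(** Both derivatives are limits of the same difference quotients. *)
Lemma is_derive_line f y v (t : R) : derivable f (y + t *: v) v ->
  is_derive t (1 : R) (fun t : R => f (y + t *: v)) ('D_v f (y + t *: v)).
Proof.
have E : (fun h : R => h^-1 *: (((fun t => f (y + t *: v)) \o shift t) (h *: 1)
        - f (y + t *: v)))
    = (fun h : R => h^-1 *: ((f \o shift (y + t *: v)) (h *: v)
        - f (y + t *: v))).
  apply/funext => h /=; congr (_ *: (f _ - _)).
  by rewrite [h *: 1]mulr1 scalerDl addrCA.
by move=> df; split; rewrite /derivable /derive E.
Qed.

(** Mean value theorem for each coordinate of the gradient along the segment
from [y] to [x]. *)
Lemma grad_lipschitz f (M : R) : twice_differentiable f ->
    (forall x, opnorm (hessian f x) <= M) ->
  forall x y j, `|grad f x 0 j - grad f y 0 j| <= M * enorm (x - y).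
Proof.
move=> [_ df] fM x y j; set v := x - y.
pose g (z : 'rV[R]_n) : R := grad f z 0 j.
have dg z : derivable g z v.
  by have /derivable_mxP := @diff_derivable _ _ _ _ _ v (df z); exact.
have Dg z : 'D_v g z = (v *m hessian f z) 0 j.
  rewrite -deriveEjacobian//.
  by rewrite derive_mx ?mxE//; exact: diff_derivable.
pose h (t : R) : R := g (y + t *: v).
have dh (t : R) : is_derive t (1 : R) h ('D_v g (y + t *: v)).
  exact: is_derive_line.
have [|c _] := @MVT_segment R h _ 0 1 ler01 (fun t _ => dh t).
  apply: continuous_subspaceT => t; apply: differentiable_continuous.
  by apply/derivable1_diffP; case: (dh t).
have -> : h 1 = g x by rewrite /h scale1r /v addrC subrK.
have -> : h 0 = g y by rewrite /h scale0r addr0.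
rewrite subr0 mulr1 => ->; rewrite Dg (le_trans (le_coord_enorm _ _))//.
by rewrite (le_trans (enorm_mulmx_le _ _))// ler_wpM2r ?enorm_ge0.
Qed.

(** All measurability needed for the integrands comes from this lemma, since
their Lipschitz bounds are proved anyway. *)
Lemma lipschitz_measurable f (c : R) :
  (forall x y, `|f x - f y| <= c * enorm (x - y)) ->
  measurable_fun [set: 'rV[R]_n] f.
Proof.
move=> fc.
have cf : continuous f.
  move=> x; apply/(@cvgrPdist_lt _ R^o _ _ (nbhs_filter x)) => e e0.
  pose b := `|c| * n%:R + 1; have b0 : 0 < b by rewrite ltr_wpDl// mulr_ge0.
  have := nbhsx_ballx x (e / b) (divr_gt0 e0 b0).
  apply: filterS => y; rewrite -ball_normE /= => xy.
  rewrite (le_lt_trans (fc x y))//.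
  have : enorm (x - y) <= n%:R * `|x - y|.
    apply: enorm_le_coord => j.
    by rewrite [leRHS]mx_normrE (le_bigmax _ (fun i => `|(x - y) i.1 i.2|) (0, j)).
  move: xy; rewrite ltr_pdivlMr// /b mulrDr mulr1 => xy en.
  apply: le_lt_trans xy.
  rewrite (@le_trans _ _ (`|c| * (n%:R * `|x - y|)))//.
    by rewrite (le_trans (ler_wpM2r (enorm_ge0 _) (ler_norm c)))// ler_wpM2l.
  by rewrite mulrA mulrC lerDl.
apply: (@measurability _ _ 'rV[R]_n (measurableTypeR R) setT f
  _ (RGenOpens.measurableE R)).
move=> _ [_ [a [b ->]] <-]; rewrite setTI; apply: rV_open_measurable.
by apply: open_comp; [move=> x _; exact: cf|exact: interval_open].
Qed.

Lemma grad_ln_potential (p : 'rV[R]_n -> R) x :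
  differentiable (potential p) x ->
  grad (fun y => ln (p y)) x = - grad (potential p) x.
Proof.
move=> dp; apply/rowP => j; rewrite !mxE -deriveN; last exact: diff_derivable.
by congr ('D_ _ _ _); apply/funext => y; rewrite fctE /potential opprK.
Qed.

End gradients.

(** * Reproducing kernel Hilbert spaces *)

Section reproducing_kernel.
Context {R : realType} (X : Type) (k : X -> X -> R) (H : rkhs k).

Lemma rk_dot_cauchy_schwarz f g : rk_mem H f -> rk_mem H g ->
  rk_dot H f g ^+ 2 <= rk_dot H f f * rk_dot H g g.
Proof.
move=> Hf Hg; apply: quadratic_ge0_discr; last exact: rk_dot_ge0.
move=> t; have Hh := rk_mem_lin t Hg Hf.
have := rk_dot_ge0 Hh.
rewrite rk_dot_lin// (rk_dot_sym Hg Hh) (rk_dot_sym Hf Hh) !rk_dot_lin//.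
by rewrite (rk_dot_sym Hg Hf); congr (_ <= _); ring.
Qed.

(** The value f(x) is the inner product of f with k(x, .). *)
Lemma rk_eval_le f x (a b : R) : rk_mem H f -> rk_norm H f <= a ->
  rk_norm H (k x) <= b -> `|f x| <= a * b.
Proof.
move=> Hf fa kb; have Hk := rk_kernel H x.
rewrite -(rk_reproducing x Hf); apply: le_trans (ler_pM _ _ fa kb).
- rewrite -sqrtr_sqr -sqrtrM ?rk_dot_ge0// ler_wsqrtr//.
  exact: rk_dot_cauchy_schwarz.
- exact: sqrtr_ge0.
- exact: sqrtr_ge0.
Qed.

Lemma rkv_norm_ge_coord n (f : X -> 'rV[R]_n) i : rkv_mem H f ->
  rk_norm H (fun x => f x 0 i) <= rkv_norm H f.
Proof.
move=> Hf; apply: ler_wsqrtr; rewrite /rkv_dot (bigD1 i)//= lerDl.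
by rewrite sumr_ge0// => j _; exact: rk_dot_ge0.
Qed.

End reproducing_kernel.

(** * Integrals over a coupling *)

Section measurable_distance.
Context {R : realType} {n : nat}.

Lemma measurable_enorm : measurable_fun [set: 'rV[R]_n] (@enorm R n).
Proof.
apply: (@lipschitz_measurable R n _ 1) => x y.
rewrite mul1r ler_norml; apply/andP; split.
  rewrite lerNl opprB lerBlDr -(enormN (x - y)) opprB.
  by rewrite -{1}(subrK x y) enorm_triangle.
by rewrite lerBlDr -{1}(subrK y x) enorm_triangle.
Qed.

Lemma measurable_enormB d (T : measurableType d) (f g : T -> 'rV[R]_n) :
  measurable_fun [set: T] f -> measurable_fun [set: T] g ->
  measurable_fun [set: T] (fun t => enorm (f t - g t)).
Proof.
move=> mf mg; apply: (measurableT_comp measurable_enorm).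
apply: rV_measurable_funP => j.
rewrite [X in measurable_fun _ X](_ : _ = (fun t => f t 0 j - g t 0 j)); last first.
  by apply/funext => t; rewrite !mxE.
by apply: measurable_funB; exact: (measurableT_comp (rV_measurable_coord j)).
Qed.

End measurable_distance.

Section integrals_over_a_coupling.
Context {R : realType} {n : nat}.
Implicit Types (rho : probability 'rV[R]_n R) (F : 'rV[R]_n -> R).

Lemma bounded_integrable d (T : measurableType d) (P : probability T R)
    (f : T -> R) (C : R) :
  measurable_fun [set: T] f -> (forall t, `|f t| <= C) ->
  P.-integrable [set: T] (EFin \o f).
Proof.
move=> mf fC; apply: measurable_bounded_integrable => //.
  by rewrite /= probability_setT ltry.
exists C; split; first exact: num_real.
by move=> y Cy t _; exact: le_trans (fC t) (ltW Cy).
Qed.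

Lemma Rintegral_marginal d d' (T : measurableType d) (U : measurableType d')
    (g : probability T R) (rho : probability U R)
    (h : T -> U) (F : U -> R) (C : R) :
  measurable_fun [set: T] h -> measurable_fun [set: U] F ->
  (forall x, `|F x| <= C) ->
  (forall A, measurable A -> g (h @^-1` A) = rho A) ->
  \int[rho]_x F x = \int[g]_z F (h z).
Proof.
move=> mh mF FC gh; rewrite /Rintegral; congr fine.
have mF' : measurable_fun [set: U] (EFin \o F) by exact/measurable_EFinP.
have intF : g.-integrable [set: T] ((EFin \o F) \o h).
  apply: (@bounded_integrable _ _ _ (F \o h) C) => [|t]; last exact: FC.
  exact: measurableT_comp.
rewrite -[RHS](integral_pushforward mh mF' intF measurableT).
by apply: eq_measure_integral => A mA _; exact: esym (gh A mA).
Qed.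

(** Both integrals are integrals of the coupling, so their difference is the
integral of F1(x) - F2(y), to which the pointwise bound applies; Lyapunov's
inequality passes from the first moment of |x - y| to [w]. *)
Lemma coupling_Rintegral_dist rho1 rho2 g F1 F2 (C K w c : R) :
  coupling rho1 rho2 g ->
  measurable_fun [set: 'rV[R]_n] F1 -> measurable_fun [set: 'rV[R]_n] F2 ->
  (forall x, `|F1 x| <= C) -> (forall x, `|F2 x| <= C) ->
  0 <= K -> 0 <= c -> 0 <= w ->
  (\int[g]_z (enorm (z.1 - z.2) ^+ 2)%:E <= (w ^+ 2)%:E)%E ->
  (forall x y, `|F1 x - F2 y| <= K * enorm (x - y) + c) ->
  `|\int[rho1]_x F1 x - \int[rho2]_x F2 x| <= K * w + c.
Proof.
move=> [g1 g2] mF1 mF2 F1C F2C K0 c0 w0 gw F12.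
rewrite (Rintegral_marginal measurable_fst mF1 F1C g1).
rewrite (Rintegral_marginal measurable_snd mF2 F2C g2).
have mF1g : measurable_fun [set: 'rV[R]_n * 'rV[R]_n] (fun z => F1 z.1).
  exact: (measurableT_comp mF1 measurable_fst).
have mF2g : measurable_fun [set: 'rV[R]_n * 'rV[R]_n] (fun z => F2 z.2).
  exact: (measurableT_comp mF2 measurable_snd).
have mD := measurable_enormB (@measurable_fst _ _ 'rV[R]_n 'rV[R]_n)
  (@measurable_snd _ _ 'rV[R]_n 'rV[R]_n).
have mF12 : measurable_fun [set: 'rV[R]_n * 'rV[R]_n]
    (fun z => F1 z.1 - F2 z.2) by exact: measurable_funB.
rewrite -RintegralB//; last 2 first.
- exact: bounded_integrable mF1g (fun z => F1C z.1).
- exact: bounded_integrable mF2g (fun z => F2C z.2).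
apply: le_trans (le_normr_Rintegral _ _) _ => //.
  apply: (@bounded_integrable _ _ _ _ (C + C)) => // z.
  by rewrite (le_trans (ler_normB _ _))// lerD.
have h0 : (0 <= \int[g]_z `|F1 z.1 - F2 z.2|%:E)%E.
  by apply: integral_ge0 => z _; rewrite lee_fin.
have h : (\int[g]_z `|F1 z.1 - F2 z.2|%:E <= (K * w + c)%:E)%E.
  have gw1 := first_moment_le mD (fun=> enorm_ge0 _) w0 gw.
  have -> : K * w + c = K * w + 0 * w + c by ring.
  apply: (integral_le_affine _ mD mD _ _ _ K0 (lexx 0) c0 gw1 gw1) => //.
  - exact: measurableT_comp.
  - by move=> z; exact: enorm_ge0.
  - by move=> z; exact: enorm_ge0.
  - by move=> z; rewrite mul0r addr0.
rewrite -lee_fin /Rintegral fineK//.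
by rewrite ge0_fin_numE// (le_lt_trans h)// ltry.
Qed.

End integrals_over_a_coupling.

(** * The Lipschitz estimate of the field *)

Section svgd_field_estimate.
Context {R : realType} {d : nat}.
Context (M CV B blip : R).
Context (M0 : 0 < M) (CV0 : 0 < CV) (B0 : 0 < B) (blip0 : 0 < blip).
Context (k : 'rV[R]_d -> 'rV[R]_d -> R) (H : rkhs k).
Context (kB : kernel_bounded B H) (klip : kernel_C1_lipschitz blip k).

Definition score (p : 'rV[R]_d -> R) : 'rV[R]_d -> 'rV[R]_d :=
  grad (fun y => ln (p y)).

Definition svgd_integrand (p : 'rV[R]_d -> R) (z : 'rV[R]_d) (j : 'I_d)
    (x : 'rV[R]_d) : R :=
  (k x z *: score p x + grad1 k x z) 0 j.

Lemma svgd_integrandE p z j x :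
  svgd_integrand p z j x = k x z * score p x 0 j + grad1 k x z 0 j.
Proof. by rewrite /svgd_integrand mxE [X in X + _]mxE. Qed.

Lemma score_le p x j : potential_bounds M CV p -> `|score p x 0 j| <= CV.
Proof.
move=> [[dp _] _ pCV]; rewrite /score grad_ln_potential// mxE normrN.
exact: le_trans (le_coord_enorm _ _) (pCV x).
Qed.

Lemma score_lipschitz p x y j : potential_bounds M CV p ->
  `|score p x 0 j - score p y 0 j| <= M * enorm (x - y).
Proof.
move=> [tp pM _]; have [dp _] := tp; rewrite /score !grad_ln_potential//.
have -> a b : (- a : 'rV[R]_d) 0 j - (- b : 'rV[R]_d) 0 j = - (a 0 j - b 0 j).
  by rewrite !mxE; ring.
by rewrite normrN; exact: grad_lipschitz.
Qed.

Lemma kernel_le x z : `|k x z| <= B ^+ 2.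
Proof.
have [kn _ _] := kB; rewrite expr2.
exact: (rk_eval_le (rk_kernel H x) (kn x) (kn z)).
Qed.

Lemma grad1_kernel_le x z j : `|grad1 k x z 0 j| <= B ^+ 2.
Proof.
have [kn gm gn] := kB; rewrite expr2.
apply: (rk_eval_le (gm x j) _ (kn z)).
exact: le_trans (rkv_norm_ge_coord j (gm x)) (gn x).
Qed.

Lemma grad1_kernel_lipschitz x z y z' j :
  `|grad1 k x z 0 j - grad1 k y z' 0 j| <= blip * (enorm (x - y) + enorm (z - z')).
Proof.
have [_ _ _ gl] := klip; apply: le_trans (gl x z y z').
have := le_coord_enorm (full_grad k x z - full_grad k y z') (lshift d j).
rewrite /full_grad.
by rewrite mxE [X in _ + X]mxE !row_mxEl.
Qed.

Lemma svgd_integrand_le p z j x : potential_bounds M CV p ->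
  `|svgd_integrand p z j x| <= B ^+ 2 * CV + B ^+ 2.
Proof.
move=> pb; rewrite svgd_integrandE (le_trans (ler_normD _ _))//.
apply: lerD; last exact: grad1_kernel_le.
by rewrite normrM ler_pM// ?kernel_le ?score_le.
Qed.

Definition svgd_lipschitz_const : R := blip * CV + blip + B ^+ 2 * M.

(** Each difference of products is split as
(k1 - k2) s1 + k2 (s1 - s2), with s1 and k2 bounded. The Hessian term gives
no |z1 - z2|; it is added to have one constant for both distances. *)
Lemma svgd_integrand_lipschitz p1 p2 (delta : R) z1 z2 x y j :
  potential_bounds M CV p1 -> potential_bounds M CV p2 ->
  (forall y, enorm (score p1 y - score p2 y) <= delta) ->
  `|svgd_integrand p1 z1 j x - svgd_integrand p2 z2 j y|
    <= svgd_lipschitz_const * enorm (x - y)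
       + (svgd_lipschitz_const * enorm (z1 - z2) + B ^+ 2 * delta).
Proof.
move=> pb1 pb2 p12.
have kl : `|k x z1 - k y z2| <= blip * (enorm (x - y) + enorm (z1 - z2)).
  by have [_ _ kl _] := klip; exact: kl.
have gl := grad1_kernel_lipschitz x z1 y z2 j.
have sl : `|score p1 x 0 j - score p2 y 0 j| <= M * enorm (x - y) + delta.
  rewrite -(subrKA (score p1 y 0 j)) (le_trans (ler_normD _ _))// lerD//.
    exact: score_lipschitz.
  have := le_coord_enorm (score p1 y - score p2 y) j.
  by rewrite mxE [X in _ + X]mxE => /le_trans; apply.
have -> : svgd_integrand p1 z1 j x - svgd_integrand p2 z2 j y
    = (k x z1 - k y z2) * score p1 x 0 j
      + k y z2 * (score p1 x 0 j - score p2 y 0 j)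
      + (grad1 k x z1 0 j - grad1 k y z2 0 j).
  by rewrite !svgd_integrandE; ring.
have e1 := ler_pM (normr_ge0 _) (normr_ge0 _) kl (score_le x j pb1).
have e2 := ler_pM (normr_ge0 _) (normr_ge0 _) (kernel_le y z2) sl.
rewrite -!normrM in e1 e2.
apply: le_trans (ler_normD _ _) _.
apply: le_trans (lerD (ler_normD _ _) (lexx _)) _.
apply: le_trans (lerD (lerD e1 e2) gl) _; rewrite /svgd_lipschitz_const -subr_ge0.
rewrite [X in 0 <= X](_ : _ = B ^+ 2 * M * enorm (z1 - z2)); last by ring.
by rewrite !mulr_ge0 ?exprn_ge0 ?enorm_ge0// ltW.
Qed.

Lemma svgd_field_coord p rho z j :
  svgd_field k p rho z 0 j = - \int[rho]_x svgd_integrand p z j x.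
Proof. by rewrite !mxE. Qed.

(** The case of equal densities and points of the integrand estimate also
supplies the measurability of the integrands. *)
Lemma svgd_field_lipschitz p1 p2 (delta w : R) rho1 rho2 g z1 z2 :
  potential_bounds M CV p1 -> potential_bounds M CV p2 ->
  (forall y, enorm (score p1 y - score p2 y) <= delta) ->
  coupling rho1 rho2 g -> 0 <= w ->
  (\int[g]_z (enorm (z.1 - z.2) ^+ 2)%:E <= (w ^+ 2)%:E)%E ->
  enorm (svgd_field k p1 rho1 z1 - svgd_field k p2 rho2 z2)
    <= d%:R * (svgd_lipschitz_const * (enorm (z1 - z2) + w) + B ^+ 2 * delta).
Proof.
move=> pb1 pb2 p12 g12 w0 gw; apply: enorm_le_coord => j.
have K0 : 0 <= svgd_lipschitz_const.
  by rewrite !addr_ge0// ?mulr_ge0 ?exprn_ge0// ltW.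
have delta0 : 0 <= delta := le_trans (enorm_ge0 _) (p12 0).
have mF p z : potential_bounds M CV p ->
    measurable_fun [set: 'rV[R]_d] (svgd_integrand p z j).
  move=> pb; apply: (@lipschitz_measurable _ _ _ svgd_lipschitz_const) => x y.
  have := @svgd_integrand_lipschitz p p 0 z z x y j pb pb.
  rewrite subrr enorm0 !mulr0 !addr0; apply => u.
  by rewrite subrr enorm0.
rewrite mxE [X in _ + X]mxE !svgd_field_coord opprK addrC distrC.
have -> : svgd_lipschitz_const * (enorm (z1 - z2) + w) + B ^+ 2 * delta
    = svgd_lipschitz_const * w
      + (svgd_lipschitz_const * enorm (z1 - z2) + B ^+ 2 * delta) by ring.
apply: (coupling_Rintegral_dist g12 (mF p1 z1 pb1) (mF p2 z2 pb2)
  (fun x => svgd_integrand_le z1 j x pb1) (fun x => svgd_integrand_le z2 j x pb2)) => //.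
- by rewrite addr_ge0// mulr_ge0 ?enorm_ge0 ?exprn_ge0// ltW.
- by move=> x y; exact: svgd_integrand_lipschitz.
Qed.

End svgd_field_estimate.

(** * The joint law as a coupling *)

Section joint_law.
Context {R : realType} {n : nat} d (Om : measurableType d) (P0 : probability Om R).
Implicit Types X Y : {RV P0 >-> 'rV[R]_n}.

Lemma measurable_pair X Y : measurable_fun [set: Om] (fun w => (X w, Y w)).
Proof. by apply: measurable_fun_pair. Qed.

Definition joint X Y : {RV P0 >-> ('rV[R]_n * 'rV[R]_n)%type} :=
  HB.pack (fun w => (X w, Y w))
    (isMeasurableFun.Build _ _ _ _ _ (measurable_pair X Y)).

Lemma coupling_joint X Y :
  coupling (distribution P0 X) (distribution P0 Y) (distribution P0 (joint X Y)).
Proof. by split. Qed.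

Lemma measurable_RV_enormB X Y :
  measurable_fun [set: Om] (fun w => enorm (X w - Y w)).
Proof. by apply: measurable_enormB. Qed.

Lemma integral_joint X Y :
  (\int[distribution P0 (joint X Y)]_z (enorm (z.1 - z.2) ^+ 2)%:E
    = \int[P0]_w (enorm (X w - Y w) ^+ 2)%:E)%E.
Proof.
rewrite ge0_integral_distribution//.
- apply/measurable_EFinP; apply: measurable_funX; apply: measurable_enormB.
    exact: measurable_fst.
  exact: measurable_snd.
- by move=> z; rewrite lee_fin sqr_ge0.
Qed.

Lemma W2_le_L2dist X Y :
  (W2 (distribution P0 X) (distribution P0 Y) <= L2dist X Y)%E.
Proof.
rewrite /W2 /L2dist unlock.
have I0 : (0 <= \int[P0]_w (enorm (X w - Y w) ^+ 2)%:E)%E.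
  by apply: integral_ge0 => w _; rewrite lee_fin sqr_ge0.
apply: gt0_ler_poweR; rewrite ?invr_ge0//.
- rewrite in_itv/= leey andbT; apply: le_ereal_inf_tmp => _ [g _ <-].
  by apply: integral_ge0 => w _; rewrite lee_fin sqr_ge0.
- by rewrite in_itv/= leey andbT.
rewrite -integral_joint; apply: ereal_inf_lbound.
by exists (distribution P0 (joint X Y)) => //; exact: coupling_joint.
Qed.

Lemma L2dist_le X Y (u : R) : 0 <= u ->
  (\int[P0]_w (enorm (X w - Y w) ^+ 2)%:E <= (u ^+ 2)%:E)%E ->
  (L2dist X Y <= u%:E)%E.
Proof.
move=> u0 XY; rewrite /L2dist unlock.
have -> : (u%:E = (u ^+ 2)%:E `^ 2^-1)%E.
  by rewrite poweR_EFin powR12_sqrt ?sqr_ge0// sqrtr_sqr ger0_norm.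
have I0 : (0 <= \int[P0]_w (enorm (X w - Y w) ^+ 2)%:E)%E.
  by apply: integral_ge0 => w _; rewrite lee_fin sqr_ge0.
apply: gt0_ler_poweR; rewrite ?invr_ge0//.
- by rewrite in_itv/= leey andbT.
- by rewrite in_itv/= leey andbT lee_fin sqr_ge0.
Qed.

End joint_law.

(** * Stability of the mean-field recursion *)

Section stability.
Context {R : realType} {d : nat}.
Implicit Types (k : 'rV[R]_d -> 'rV[R]_d -> R) (p : 'rV[R]_d -> R).

(** Stated for every coupling and every bound [w] of its root mean square cost,
rather than for the Wasserstein distance, because the recursion applies it to
the joint law directly. *)
Definition coupling_lipschitz k p1 p2 (L delta : R) : Prop :=
  forall (rho1 rho2 : probability 'rV[R]_d R) g z1 z2 w,
  coupling rho1 rho2 g -> 0 <= w ->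
  (\int[g]_z (enorm (z.1 - z.2) ^+ 2)%:E <= (w ^+ 2)%:E)%E ->
  enorm (svgd_field k p1 rho1 z1 - svgd_field k p2 rho2 z2)
    <= L * (enorm (z1 - z2) + w + delta).

(** Solved for the transport cost, the estimate bounds a constant [c] by the
cost of every coupling, hence by the infimum. *)
Lemma coupling_lipschitz_W2 k p1 p2 (L delta : R) rho1 rho2 z1 z2 :
  0 < L -> coupling_lipschitz k p1 p2 L delta ->
  ((enorm (svgd_field k p1 rho1 z1 - svgd_field k p2 rho2 z2))%:E
    <= L%:E * ((enorm (z1 - z2))%:E + W2 rho1 rho2 + delta%:E))%E.
Proof.
move=> L0 kL; set a := enorm (_ - _); set e := enorm (z1 - z2).
pose c := a / L - e - delta.
have cW : (c%:E <= W2 rho1 rho2)%E.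
  have [c0|c0] := leP c 0; first by rewrite (le_trans _ (poweR_ge0 _ _))// lee_fin.
  have -> : (c%:E = (c ^+ 2)%:E `^ 2^-1)%E.
    by rewrite poweR_EFin powR12_sqrt ?sqr_ge0// sqrtr_sqr gtr0_norm.
  have cI : ((c ^+ 2)%:E <= ereal_inf [set \int[g]_z (enorm (z.1 - z.2) ^+ 2)%:E
      | g in coupling rho1 rho2])%E.
    apply: le_ereal_inf_tmp => _ [g g12 <-].
    have : (0 <= \int[g]_z (enorm (z.1 - z.2) ^+ 2)%:E)%E.
      by apply: integral_ge0 => w _; rewrite lee_fin sqr_ge0.
    case E : (\int[g]_z (enorm (z.1 - z.2) ^+ 2)%:E)%E => [r| |]//; last first.
      by move=> _; rewrite leey.
    rewrite !lee_fin => r0.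
    have := kL rho1 rho2 g z1 z2 (Num.sqrt r) g12 (sqrtr_ge0 _).
    rewrite sqr_sqrtr// E => /(_ (lexx _)).
    rewrite -/a -/e mulrC -ler_pdivrMr// => h.
    rewrite -(sqr_sqrtr r0) ler_pXn2r ?nnegrE ?sqrtr_ge0 ?(ltW c0)//.
    by rewrite /c; lra.
  apply: gt0_ler_poweR => //.
  - by rewrite in_itv/= leey andbT lee_fin sqr_ge0.
  - by rewrite in_itv/= leey andbT (le_trans _ cI)// lee_fin sqr_ge0.
have : (0 <= W2 rho1 rho2)%E by exact: poweR_ge0.
case: (W2 rho1 rho2) cW => [r| |]//.
  rewrite !lee_fin => cr _.
  by rewrite mulrC -ler_pdivrMr//; move: cr; rewrite /c; lra.
by move=> _ _; rewrite addey// addye// gt0_muley ?lte_fin// leey.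
Qed.

Lemma coupling_lipschitz_le k p1 p2 (L L' delta delta' : R) :
  L <= L' -> L * delta <= L' * delta' ->
  coupling_lipschitz k p1 p2 L delta -> coupling_lipschitz k p1 p2 L' delta'.
Proof.
move=> LL' Ld kL rho1 rho2 g z1 z2 w g12 w0 gw.
apply: le_trans (kL _ _ _ z1 z2 w g12 w0 gw) _.
by rewrite !mulrDr lerD// -!mulrDr ler_wpM2r// addr_ge0 ?enorm_ge0.
Qed.

(** The bound u(n) solves u(n+1) = u(n) + gamma L (2 u(n) + delta), u(0) = 0:
one u(n) comes from the distance of the points and one from the distance of the
laws, both controlled by the joint law at time n. *)
Lemma mean_field_stability d' (Om : measurableType d') (P0 : probability Om R)
    (gamma : R) k p1 p2 (L delta : R) (Z Y : nat -> {RV P0 >-> 'rV[R]_d}) :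
  0 <= gamma -> 0 <= L -> 0 <= delta ->
  coupling_lipschitz k p1 p2 L delta ->
  mean_field_system gamma k p1 Z -> mean_field_system gamma k p2 Y ->
  (forall w, Z 0%N w = Y 0%N w) ->
  forall n, (\int[P0]_w (enorm (Z n w - Y n w) ^+ 2)%:E
    <= ((delta / 2 * ((1 + 2 * (gamma * L)) ^+ n - 1)) ^+ 2)%:E)%E.
Proof.
move=> gamma0 L0 delta0 kL hZ hY ZY0.
pose u n := delta / 2 * ((1 + 2 * (gamma * L)) ^+ n - 1).
have gL0 : 0 <= gamma * L by rewrite mulr_ge0.
have u0 n : 0 <= u n.
  rewrite mulr_ge0 ?divr_ge0// subr_ge0 exprn_ege1//.
  by rewrite lerDl mulr_ge0.
move=> n; rewrite -/(u n); elim: n => [|n IH].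
  under eq_integral do rewrite ZY0 subrr enorm0 expr0n.
  by rewrite integral0 lee_fin sqr_ge0.
have -> : u n.+1 = (1 + gamma * L) * u n + gamma * L * (u n + delta).
  by rewrite /u exprS; field.
apply: (second_moment_affine_le (measurable_RV_enormB (Z n) (Y n)) _ (u0 n) IH).
- by move=> w; exact: enorm_ge0.
- by rewrite addr_ge0.
- by rewrite mulr_ge0// addr_ge0.
- exact: measurable_RV_enormB.
move=> w; rewrite enorm_ge0/= hZ hY.
have /(_ (Z n w) (Y n w)) F := kL _ _ _ _ _ _ (coupling_joint (Z n) (Y n)) (u0 n).
rewrite integral_joint in F; have {}F := F IH.
set a := svgd_field _ _ _ _ in F *; set b := svgd_field _ _ _ _ in F *.
have -> : Z n w - gamma *: a - (Y n w - gamma *: b)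
    = (Z n w - Y n w) - gamma *: (a - b).
  by apply/rowP => j; rewrite !mxE; ring.
apply: le_trans (enorm_triangle _ _) _; rewrite enormN enormZ ger0_norm//.
have := ler_wpM2l gamma0 F; lra.
Qed.

Lemma compound_le_exp (c gamma T : R) (n : nat) : 0 <= c -> 0 < gamma ->
  n%:R <= T / gamma -> (1 + 2 * (gamma * c)) ^+ n <= expR (2 * c * T).
Proof.
move=> c0 g0; rewrite ler_pdivlMr// => nT.
apply: (@le_trans _ _ (expR (2 * (gamma * c)) ^+ n)).
  by rewrite lerXn2r ?nnegrE ?expR_ge0 ?expR_ge1Dx// addr_ge0// !mulr_ge0// ltW.
rewrite -expRM_natl ler_expR.
have -> : n%:R * (2 * (gamma * c)) = 2 * c * (n%:R * gamma) by ring.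
by rewrite ler_wpM2l// mulr_ge0.
Qed.

End stability.

Theorem proposition4p3 (R : realType) (d : nat) (hd : (0 < d)%N)
  (M CV B blip beta Capp : R)
  (hM : 0 < M) (hCV : 0 < CV) (hB : 0 < B) (hblip : 0 < blip)
  (hbeta : 0 < beta) (hCapp : 0 < Capp) :
  exists dlip : R, 0 < dlip /\
  forall (k : 'rV[R]_d -> 'rV[R]_d -> R) (H0 : rkhs k)
    (p : 'rV[R]_d -> R) (pl : nat -> 'rV[R]_d -> R),
    stationary k -> pos_def_kernel k ->
    prob_density p -> (forall l, prob_density (pl l)) ->
    potential_bounds M CV p -> kernel_bounded B H0 ->
    kernel_C1_lipschitz blip k ->
    (forall l, potential_bounds M CV (pl l)) -> score_approx Capp beta p pl ->
    lipschitz_estimates dlip beta k p pl /\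
    forall (T gamma : R) (rho0 : probability 'rV[R]_d R)
      (dO : measure_display) (Om : measurableType dO) (P0 : probability Om R)
      (Z : nat -> {RV P0 >-> 'rV[R]_d})
      (Zl : nat -> nat -> {RV P0 >-> 'rV[R]_d}),
      0 < T -> 0 < gamma -> in_P2 rho0 ->
      mean_field_system gamma k p Z ->
      (forall l, mean_field_system gamma k (pl l) (Zl l)) ->
      (forall A, measurable A -> distribution P0 (Z 0%N) A = rho0 A) ->
      (forall l w, Zl l 0%N w = Z 0%N w) ->
      forall n : nat, n%:R <= T / gamma ->
        (forall l : nat, (1 <= l)%N ->
          (W2 (distribution P0 (Zl l n)) (distribution P0 (Zl l.-1 n))
             <= L2dist (Zl l n) (Zl l.-1 n)
             <= (Capp * 2 `^ (- (beta * l%:R))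
                  * (expR (2 * dlip * T) - 1))%:E)%E) /\
        (forall l : nat,
          (W2 (distribution P0 (Zl l n)) (distribution P0 (Z n))
             <= L2dist (Zl l n) (Z n)
             <= (Capp * 2 `^ (- (beta * l%:R)) / 2
                  * (expR (2 * dlip * T) - 1))%:E)%E).
Proof.
pose K := svgd_lipschitz_const M CV B blip.
have K0 : 0 < K by rewrite !addr_gt0 ?mulr_gt0 ?exprn_gt0.
(* Passing from level l to l - 1 multiplies the approximation error by b. *)
pose b := 2 `^ beta; have b0 : 0 <= b by exact: powR_ge0.
pose L := d%:R * (K + B ^+ 2 * (1 + b)).
have L0 : 0 < L.
  by rewrite mulr_gt0 ?ltr0n// ltr_wpDr// mulr_ge0 ?exprn_ge0 ?addr_ge0// ltW.
exists (L * (1 + Capp)); split; first by rewrite mulr_gt0// addr_gt0.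
move=> k H0 p pl _ _ _ _ pb kB kl plb app.
pose q l := 2 `^ (- (beta * l%:R)) : R.
have q0 l : 0 <= q l by exact: powR_ge0.
have estimate p1 p2 delta : potential_bounds M CV p1 -> potential_bounds M CV p2 ->
    0 <= delta -> (forall y, enorm (score p1 y - score p2 y) <= (1 + b) * delta) ->
    coupling_lipschitz k p1 p2 L delta.
  move=> pb1 pb2 delta0 p12 rho1 rho2 g z1 z2 w g12 w0 gw.
  have := svgd_field_lipschitz hM hCV hB hblip kB kl z1 z2 pb1 pb2 p12 g12 w0 gw.
  move=> /le_trans; apply; rewrite -/K /L -mulrA ler_wpM2l//.
  have := enorm_ge0 (z1 - z2); set e := enorm _ => e0.
  rewrite -subr_ge0 [X in 0 <= X](_ : _
    = K * delta + B ^+ 2 * (1 + b) * (e + w)); last by ring.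
  by rewrite !(addr_ge0, mulr_ge0, exprn_ge0)// ltW.
have est l : coupling_lipschitz k (pl l) p L (Capp * q l).
  apply: estimate => //; first by rewrite mulr_ge0// ltW.
  move=> y; rewrite (le_trans (app l y))// -/(q l) mulrDl mul1r lerDl.
  by rewrite !mulr_ge0// ltW.
have est_succ l : (1 <= l)%N -> coupling_lipschitz k (pl l) (pl l.-1) L (Capp * q l).
  case: l => // l _; apply: estimate => //; first by rewrite mulr_ge0// ltW.
  move=> y; rewrite -(subrKA (score p y)) (le_trans (enorm_triangle _ _))//.
  rewrite mulrDl mul1r lerD//; first exact: app.
  rewrite -enormN opprB (le_trans (app l y))//.
  rewrite mulrCA ler_wpM2l ?(ltW hCapp)// /b /q -powRD ?pnatr_eq0 ?implybT//.
  by rewrite -[l.+1%:R]natr1 mulrDr mulr1 opprD addrCA subrr addr0.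
pose L' := L * (1 + Capp).
have LL' : L <= L' by rewrite ler_peMr ?(ltW L0)// lerDl ltW.
have L'0 : 0 < L' by exact: lt_le_trans LL'.
have weaken p1 p2 l : coupling_lipschitz k p1 p2 L (Capp * q l) ->
    coupling_lipschitz k p1 p2 L' (q l).
  apply: coupling_lipschitz_le => //; rewrite mulrA ler_wpM2r//.
  by rewrite ler_wpM2l ?(ltW L0)// lerDr.
have strengthen p1 p2 l : coupling_lipschitz k p1 p2 L (Capp * q l) ->
    coupling_lipschitz k p1 p2 L' (Capp * q l).
  by apply: coupling_lipschitz_le => //; rewrite ler_wpM2r// mulr_ge0// ltW.
split=> [z1 z2 rho1 rho2 _ _|].
  split=> l => [l1|]; apply: coupling_lipschitz_W2 => //; apply: weaken.
    exact: est_succ.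
  exact: est.
move=> T gamma rho0 dO Om P0 Z Zl T0 g0 _ hZ hZl _ Zl0 n nT.
have bound p1 p2 l (X Y : nat -> {RV P0 >-> 'rV[R]_d}) :
    coupling_lipschitz k p1 p2 L (Capp * q l) ->
    mean_field_system gamma k p1 X -> mean_field_system gamma k p2 Y ->
    (forall w, X 0%N w = Y 0%N w) ->
    (L2dist (X n) (Y n)
      <= (Capp * q l / 2 * (expR (2 * L' * T) - 1))%:E)%E.
  move=> /strengthen kL hX hY XY0.
  have delta0 : 0 <= Capp * q l by rewrite mulr_ge0// ltW.
  have h := mean_field_stability (ltW g0) (ltW L'0) delta0 kL hX hY XY0 n.
  apply: le_trans (L2dist_le _ h) _.
    rewrite mulr_ge0 ?divr_ge0// subr_ge0 exprn_ege1// lerDl.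
    by rewrite mulr_ge0// mulr_ge0 ?(ltW g0) ?(ltW L'0).
  rewrite lee_fin ler_wpM2l ?divr_ge0// lerB//.
  exact: compound_le_exp (ltW L'0) g0 nT.
split=> l => [l1|]; rewrite W2_le_L2dist/=.
  apply: le_trans (bound _ _ l _ _ (est_succ l l1) (hZl l) (hZl l.-1) _) _.
    by move=> w; rewrite !Zl0.
  have E1 : 1 <= expR (2 * L' * T).
    by rewrite -expR0 ler_expR mulr_ge0 ?(ltW T0)// mulr_ge0 ?(ltW L'0).
  rewrite lee_fin ler_wpM2r ?subr_ge0// ler_pdivrMr//.
  rewrite ler_peMr ?mulr_ge0 ?(ltW hCapp)//.
  by rewrite ler1n.
exact: bound (est l) (hZl l) hZ (Zl0 l).
Qed.
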